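(* Let $z^*$ be the optimal value of (S-CFLP). Let $x^{H}$ be the $x$-part of an optimal solution $(x,\lambda,\mu,s,t)$ of the mixed-integer second-order conic program \begin{align*} \min\ & \sum_{i\in I}h_iU_i^F s_i+r\lambda+\sum_{j\in J}\mu_j\\ \text{s.t. }& \lambda+\mu_j\ge\sum_{i\in I}h_iw_{ij}t_{ij},\quad\forall j\in J,\\ &\left\|\begin{bmatrix}2\\ U_i^L+\sum_{k\in J}w_{ik}x_k-s_i\end{bmatrix}\right\|_2\le s_i+U_i^L+\sum_{k\in J}w_{ik}x_k,\quad\forall i\in I,\\ &\left\|\begin{bmatrix}2(1-x_j)\\ U_i^L+\sum_{k\in J}w_{ik}x_k-t_{ij}\end{bmatrix}\right\|_2\le t_{ij}+U_i^L+\sum_{k\in J}w_{ik}x_k,\quad\forall i\in I,\ j\in J,\\ & x\in\mathcal{X},\ \lambda\in\mathbb{R},\ \mu\in\mathbb{R}^{J}_{\geq 0},\ s\in\mathbb{R}^{I}_{\ge 0},\ t\in\mathbb{R}^{I\times J}_{\ge 0}, \end{align*} and let $z^{H}:=\min_{y\in\mathcal{Y}}L(x^{H},y)$ be the objective value of $x^H$ in (S-CFLP). Then $$\frac{4\gamma_M\gamma_m}{(\gamma_M+\gamma_m)^2}\ \le\ \frac{z^{H}}{z^*}\ \le\ 1,$$ where $$\gamma_m:=\min_{i\in I}\left\{\frac{1}{1+\dfrac{\max_{y\in\overline{\mathcal{Y}}}\{U_i^F+\sum_{j\in J}w_{ij}y_j\}}{\min_{x\in\overline{\mathcal{X}}}\{U_i^L+\sum_{j\in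 J}w_{ij}x_j\}}}\right\},\qquad \gamma_M:=\max_{i\in I}\left\{\frac{1}{1+\dfrac{\min_{y\in\overline{\mathcal{Y}}}\{U_i^F+\sum_{j\in J}w_{ij}y_j\}}{\max_{x\in\overline{\mathcal{X}}}\{U_i^L+\sum_{j\in J}w_{ij}x_j\}}}\right\},$$ with $\overline{\mathcal{X}}:=\{x\in\{0,1\}^{|J|}:\sum_{j\in J}x_j=p\}$ and $\overline{\mathcal{Y}}:=\{y\in\{0,1\}^{|J|}:\sum_{j\in J}y_j=r\}$.
   Context: Setting (sequential competitive facility location with a leader L and a follower F). $I$ is a finite nonempty set of customer nodes; $J$ (candidate sites), $J^L$ and $J^F$ (pre-existing facilities of leader and follower) are finite pairwise disjoint sets. Demand weights $h_i\ge 0$ satisfy $\sum_{i\in I}h_i=1$. With real attractiveness levels $\alpha_j$, distances $d_{ij}\ge 0$ and $\beta>0$, set $w_{ij}:=\exp\{\alpha_j-\beta d_{ij}\}>0$ for $i\in I$, $j\in J\cup J^L\cup J^F$, and $U_i^L:=\sum_{j\in J^L}w_{ij}\ge 0$, $U_i^F:=\sum_{j\in J^F}w_{ij}\ge 0$. The budgets $p,r$ are positive integers with $p+r\le |J|$. Notation: $a\vee b:=\max\{a,b\}$. Let $\mathcal{X}:=\{x\in\{0,1\}^{|J|}:\sum_j x_j\le p\}$, $\mathcal{Y}:=\{y\in\{0,1\}^{|J|}:\sum_j y_j\le r\}$, $\mathcal{Y}(x):=\{y\in\mathcal{Y}:y_j\le 1-x_j\ \forall j\in J\}$, and $$L^{+}(x,y):=\sum_{i\in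 I}h_i\,\frac{U^L_i+\sum_{j}w_{ij}x_j}{U^L_i+U^F_i+\sum_{j}w_{ij}(x_j+y_j)},\qquad L(x,y):=\sum_{i\in I}h_i\,\frac{U^L_i+\sum_{j}w_{ij}x_j}{U^L_i+U^F_i+\sum_{j}w_{ij}(x_j\vee y_j)}.$$ (S-CFLP) is the bilevel problem $\max_{x\in\mathcal{X}}L^+(x,y^* )$ where $y^*\in\operatorname{argmax}_{y\in\mathcal{Y}(x)}\sum_{i\in I}h_i\frac{U_i^F+\sum_j w_{ij}y_j}{U_i^L+U_i^F+\sum_j w_{ij}(x_j+y_j)}$; since the leader's and follower's shares sum to $1$, it is the same as $\max_{x\in\mathcal{X}}\min_{y\in\mathcal{Y}(x)}L^+(x,y)$, which also equals $\max_{x\in\mathcal{X}}\min_{y\in\mathcal{Y}}L(x,y)$. Convention: $0/0:=0$ (this only matters when $U_i^L=U_i^F=0$ and $x=y=0$). *)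

(* Defs.v *)
From HB Require Import structures.
From mathcomp Require Import all_boot all_order all_algebra.
From mathcomp Require Import reals sequences exp.

Set Implicit Arguments.
Unset Strict Implicit.
Unset Printing Implicit Defensive.

Import Order.TTheory GRing.Theory Num.Theory.
Local Open Scope ring_scope.

(* Minimum and maximum of [f] over a nonempty finite set [A]; the value 0 on
   the empty set is a dummy. *)
Definition fmin (R : realType) (T : finType) (A : {set T}) (f : T -> R) : R :=
  if [pick a in A] is Some a0 then f [arg min_(a < a0 in A) f a]%O else 0.

Definition fmax (R : realType) (T : finType) (A : {set T}) (f : T -> R) : R :=
  if [pick a in A] is Some a0 then f [arg max_(a > a0 in A) f a]%O else 0.

Lemma fminP (R : realType) (T : finType) (A : {set T}) (f : T -> R) :
  A != set0 ->
  (exists2 a, a \in A & fmin A f = f a) /\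
  (forall a, a \in A -> fmin A f <= f a).
Proof.
case/set0Pn=> b bA; rewrite /fmin; case: pickP => [a0 a0A|/(_ b)]; last first.
  by rewrite bA.
by case: arg_minP => // a aA amin; split=> //; exists a.
Qed.

Lemma fmaxP (R : realType) (T : finType) (A : {set T}) (f : T -> R) :
  A != set0 ->
  (exists2 a, a \in A & fmax A f = f a) /\
  (forall a, a \in A -> f a <= fmax A f).
Proof.
case/set0Pn=> b bA; rewrite /fmax; case: pickP => [a0 a0A|/(_ b)]; last first.
  by rewrite bA.
by case: arg_maxP => // a aA amax; split=> //; exists a.
Qed.

(* The matrix norm of the library is the sup norm, so the Euclidean norm is
   defined here. *)
Definition norm2 (R : realType) (n : nat) (v : 'cV[R]_n) : R :=
  Num.sqrt (\sum_i v i 0 ^+ 2).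

Definition vec2 (R : realType) (a b : R) : 'cV[R]_2 :=
  \col_i (if i == 0 then a else b).

(* Data of a competitive facility location problem: customers [I], candidate
   sites [J], pre-existing leader facilities [JL] and follower facilities [JF].
   Facilities range over the disjoint union of the last three. *)
Record cflp (R : realType) (I J JL JF : finType) := Cflp {
  demand : I -> R;
  attr : J + JL + JF -> R;
  dist : I -> J + JL + JF -> R;
  decay : R;
  lbudget : nat;
  fbudget : nat
}.

Section Model.
Variables (R : realType) (I J JL JF : finType) (P : cflp R I J JL JF).

Notation h := (demand P).
Notation p := (lbudget P).
Notation r := (fbudget P).

Definition weight (i : I) (j : J + JL + JF) : R :=
  expR (attr P j - decay P * dist P i j).

Definition w (i : I) (j : J) : R := weight i (inl (inl j)).
Definition UL (i : I) : R := \sum_(j : JL) weight i (inl (inr j)).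
Definition UF (i : I) : R := \sum_(j : JF) weight i (inr j).

(* Vectors of {0,1}^J, with at most (resp. exactly) [n] ones. *)
Definition binary_le (n : nat) : {set {ffun J -> bool}} :=
  [set x : {ffun J -> bool} | (\sum_j x j <= n)%N].
Definition binary_eq (n : nat) : {set {ffun J -> bool}} :=
  [set x : {ffun J -> bool} | (\sum_j x j)%N == n].

Definition X : {set {ffun J -> bool}} := binary_le p.
Definition Y : {set {ffun J -> bool}} := binary_le r.
Definition Xbar : {set {ffun J -> bool}} := binary_eq p.
Definition Ybar : {set {ffun J -> bool}} := binary_eq r.
Definition Yof (x : {ffun J -> bool}) : {set {ffun J -> bool}} :=
  [set y in Y | [forall j, (y j <= 1 - x j)%N]].

(* Division by 0 yields 0 in the library, which is the convention 0/0 = 0. *)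
Definition leader_share (x y : {ffun J -> bool}) : R :=
  \sum_i h i * ((UL i + \sum_j w i j * (x j)%:R) /
    (UL i + UF i + \sum_j w i j * ((x j)%:R + (y j)%:R))).

Definition follower_share (x y : {ffun J -> bool}) : R :=
  \sum_i h i * ((UF i + \sum_j w i j * (y j)%:R) /
    (UL i + UF i + \sum_j w i j * ((x j)%:R + (y j)%:R))).

Definition follower_optimal (x y : {ffun J -> bool}) : Prop :=
  y \in Yof x /\
  forall y', y' \in Yof x -> follower_share x y' <= follower_share x y.

(* Optimal value of the bilevel program. The leader's share does not depend on
   which optimal follower response is selected, so the quantification over all
   of them does not commit to an optimistic or a pessimistic reading. *)
Definition scflp_optimal_value (z : R) : Prop :=
  (exists x y, [/\ x \in X, follower_optimal x y & z = leader_share x y]) /\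
  (forall x y, x \in X -> follower_optimal x y -> leader_share x y <= z).

Definition L (x y : {ffun J -> bool}) : R :=
  \sum_i h i * ((UL i + \sum_j w i j * (x j)%:R) /
    (UL i + UF i + \sum_j w i j * Num.max (x j)%:R (y j)%:R)).

Definition scflp_objective (x : {ffun J -> bool}) : R := fmin Y (L x).

Definition leader_attraction (x : {ffun J -> bool}) (i : I) : R :=
  UL i + \sum_j w i j * (x j)%:R.
Definition follower_attraction (y : {ffun J -> bool}) (i : I) : R :=
  UF i + \sum_j w i j * (y j)%:R.

Record socp_feasible (x : {ffun J -> bool}) (lam : R) (mu : J -> R)
    (s : I -> R) (t : I -> J -> R) : Prop := SocpFeasible {
  socp_dual : forall j, lam + mu j >= \sum_i h i * w i j * t i j;
  socp_cone_s : forall i,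
    norm2 (vec2 2 (leader_attraction x i - s i))
      <= s i + leader_attraction x i;
  socp_cone_t : forall i j,
    norm2 (vec2 (2 * (1 - (x j)%:R)) (leader_attraction x i - t i j))
      <= t i j + leader_attraction x i;
  socp_x : x \in X;
  socp_mu : forall j, 0 <= mu j;
  socp_s : forall i, 0 <= s i;
  socp_t : forall i j, 0 <= t i j
}.

Definition socp_cost (lam : R) (mu : J -> R) (s : I -> R) : R :=
  \sum_i h i * UF i * s i + r%:R * lam + \sum_j mu j.

Definition socp_optimal (x : {ffun J -> bool}) (lam : R) (mu : J -> R)
    (s : I -> R) (t : I -> J -> R) : Prop :=
  socp_feasible x lam mu s t /\
  forall x' lam' mu' s' t', socp_feasible x' lam' mu' s' t' ->
    socp_cost lam mu s <= socp_cost lam' mu' s'.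

Definition gamma_m : R :=
  fmin [set: I] (fun i => 1 /
    (1 + fmax Ybar (follower_attraction^~ i) /
         fmin Xbar (leader_attraction^~ i))).

Definition gamma_M : R :=
  fmax [set: I] (fun i => 1 /
    (1 + fmin Ybar (follower_attraction^~ i) /
         fmax Xbar (leader_attraction^~ i))).

End Model.

(* Main.v *)
(* At fixed x the SOCP minimises over (lam, mu, s, t) the LP dual of
   max_y sum_i h_i B_i / A_i, with A_i the leader's attraction and B_i the
   follower's, so its value c(x) is the maximal mean ratio.  The leader's share
   is sum_i h_i u_i with u_i = 1 / (1 + B_i / A_i), whereas
   1 + sum_i h_i B_i / A_i = sum_i h_i / u_i.  The harmonic-arithmetic mean
   inequality at xH gives zH >= 1 / (1 + c(xH)) >= 1 / (1 + c(x)) for any other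
   x with nonzero attractions, and Kantorovich's inequality, applied to an
   optimal leader decision completed to exactly p sites and to the r best
   remaining sites for the follower, bounds 1 / (1 + c(x)) below by the
   constant times zstar. *)
Require Import Defs.
From mathcomp Require Import all_boot all_order all_algebra.
From mathcomp Require Import reals sequences exp.
From mathcomp Require Import ring lra.

Set Implicit Arguments.
Unset Strict Implicit.
Unset Printing Implicit Defensive.

Import Order.TTheory GRing.Theory Num.Theory.
Local Open Scope ring_scope.

(** Greedy selection: each step adds a maximiser of [c] over what remains of [A], so every element
    still left out stays below it. *)
Lemma top_subset (R : realType) (T : finType) (c : T -> R) (A : {set T})
    (n : nat) :
  (n <= #|A|)%N ->
  exists B : {set T}, [/\ B \subset A, #|B| = n &
    forall a b, a \in A -> a \notin B -> b \in B -> c a <= c b].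
Proof.
elim: n => [_|n IHn ltnA].
  by exists set0; split=> [||a b]; rewrite ?sub0set ?cards0 ?inE.
have [B [sBA cardB topB]] := IHn (ltnW ltnA).
have DB_neq0 : A :\: B != set0.
  by rewrite -card_gt0 cardsD (setIidPr sBA) cardB subn_gt0.
have [[a0 /[!inE] /andP[a0B a0A] ->] maxa0] := fmaxP c DB_neq0.
exists (a0 |: B); split.
- by rewrite subUset sub1set a0A.
- by rewrite cardsU1 a0B cardB.
- move=> a b aA; rewrite !inE negb_or => /andP[_ aB] /predU1P[->|bB].
    by apply: maxa0; rewrite inE aB.
  exact: topB.
Qed.

(** * Weighted mean inequalities *)

Lemma kantorovich_constant_ge0 (R : realType) (m M : R) :
  0 < m -> m <= M -> 0 <= 4 * M * m / (M + m) ^+ 2.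
Proof. by move=> ? ?; rewrite divr_ge0 ?sqr_ge0 // !mulr_ge0 //; lra. Qed.

Section WeightedMeans.
Variables (R : realType) (I : finType) (h : I -> R).
Hypothesis h_ge0 : forall i, 0 <= h i.
Hypothesis h_sum1 : \sum_i h i = 1.

(* The tangent of u |-> 1 / u at 1 + c bounds each term from below. *)
Lemma harmonic_le_arithmetic (rho : I -> R) (c : R) :
  (forall i, 0 <= rho i) -> \sum_i h i * rho i <= c ->
  (1 + c)^-1 <= \sum_i h i * (1 + rho i)^-1.
Proof.
move=> rho_ge0 le_c.
have c_ge0 : 0 <= c.
  by apply: le_trans le_c; apply: sumr_ge0 => i _; rewrite mulr_ge0.
set v := (1 + c)^-1.
have v_gt0 : 0 < v by rewrite invr_gt0; lra.
have vK : v * (1 + c) = 1 by rewrite mulVf //; lra.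
have tangent i : 2 * v - (1 + rho i) * v ^+ 2 <= (1 + rho i)^-1.
  have := rho_ge0 i; set q := rho i => q_ge0.
  have u_gt0 : 0 < (1 + q)^-1 by rewrite invr_gt0; lra.
  have uK : (1 + q)^-1 * (1 + q) = 1 by rewrite mulVf //; lra.
  have : 0 <= (1 + q) * ((1 + q)^-1 - v) ^+ 2.
    by rewrite mulr_ge0 ?sqr_ge0 //; lra.
  set u := (1 + q)^-1 in u_gt0 uK *.
  have -> : (1 + q) * (u - v) ^+ 2
    = (u * (1 + q)) * u - 2 * v * (u * (1 + q)) + (1 + q) * v ^+ 2 by ring.
  by rewrite uK; lra.
apply: (@le_trans _ _ (\sum_i h i * (2 * v - (1 + rho i) * v ^+ 2)));
  last first.
  by apply: ler_sum => i _; apply: ler_wpM2l.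
have -> : \sum_i h i * (2 * v - (1 + rho i) * v ^+ 2)
  = (\sum_i h i) * (2 * v - v ^+ 2) - v ^+ 2 * \sum_i h i * rho i.
  by rewrite mulr_suml mulr_sumr -sumrB; apply: eq_bigr => i _; ring.
(* As [v * (1 + c) = 1], the summed tangents are at least [2 * v - v ^+ 2 * (1 + c) = v]. *)
have : v ^+ 2 * (1 + \sum_i h i * rho i) <= v ^+ 2 * (1 + c).
  by rewrite ler_wpM2l ?sqr_ge0 // lerD2l.
rewrite h_sum1 mul1r.
have -> : v ^+ 2 * (1 + c) = v * (v * (1 + c)) by ring.
by rewrite vK; lra.
Qed.

(* (u - m)(M - u) >= 0 makes u + M m / u <= M + m; then AM-GM on the sums. *)
Lemma kantorovich (rho : I -> R) (m M : R) :
  0 < m -> m <= M -> (forall i, 0 <= rho i) ->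
  (forall i, m <= (1 + rho i)^-1 <= M) ->
  4 * M * m / (M + m) ^+ 2 * (\sum_i h i * (1 + rho i)^-1)
    <= (1 + \sum_i h i * rho i)^-1.
Proof.
move=> m_gt0 lemM rho_ge0 bounds.
set S := \sum_i h i * (1 + rho i)^-1; set T := 1 + _.
have T_gt0 : 0 < T.
  by rewrite ltr_wpDr //; apply: sumr_ge0 => i _; rewrite mulr_ge0.
have S_ge0 : 0 <= S.
  by apply: sumr_ge0 => i _; rewrite mulr_ge0 // invr_ge0 addr_ge0.
have sum_le : S + M * m * T <= M + m.
  have -> : S + M * m * T
    = \sum_i h i * ((1 + rho i)^-1 + M * m * (1 + rho i)).
    transitivity (S + M * m * (\sum_i h i + \sum_i h i * rho i)).
      by rewrite h_sum1.
    rewrite -big_split mulr_sumr -big_split /=.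
    by apply: eq_bigr => i _; ring.
  have -> : M + m = \sum_i h i * (M + m) by rewrite -mulr_suml h_sum1 mul1r.
  apply: ler_sum => i _; apply: ler_wpM2l => //.
  have /andP[] := bounds i; have := rho_ge0 i; set q := rho i => q_ge0.
  have uK : (1 + q)^-1 * (1 + q) = 1 by rewrite mulVf //; lra.
  set u := (1 + q)^-1 in uK * => le_mu le_uM.
  have : 0 <= (1 + q) * ((u - m) * (M - u)).
    by rewrite !mulr_ge0 ?subr_ge0 //; lra.
  have -> : (1 + q) * ((u - m) * (M - u))
    = (u * (1 + q)) * (M + m - u) - M * m * (1 + q) by ring.
  by rewrite uK; lra.
have Mm_gt0 : 0 < M * m by rewrite mulr_gt0 //; lra.
have sq_gt0 : 0 < (M + m) ^+ 2 by rewrite exprn_gt0 //; lra.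
(* Clearing both denominators leaves [4 * M * m * S * T <= (M + m) ^+ 2]. *)
rewrite -[leRHS]mul1r ler_pdivlMr // mulrAC -mulrA mulrAC ler_pdivrMr // mul1r.
have : (S + M * m * T) ^+ 2 <= (M + m) ^+ 2.
  rewrite ler_pXn2r // ?nnegrE; first by rewrite addr_ge0 // mulr_ge0 // ltW.
  by lra.
have : 0 <= (S - M * m * T) ^+ 2 by rewrite sqr_ge0.
by rewrite !expr2; lra.
Qed.

End WeightedMeans.

(** Squaring both sides, [(s + A) ^+ 2 - (A - s) ^+ 2 = 4 * (s * A)]. The cones of the program thus
    say [s i * A x i >= 1] and [t i j * A x i >= (1 - x j) ^+ 2]. *)
Lemma norm2_cone (R : realType) (a s A : R) :
  0 <= s -> 0 <= A ->
  (norm2 (vec2 a (A - s)) <= s + A) = (a ^+ 2 <= 4 * (s * A)).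
Proof.
move=> s_ge0 A_ge0; have sA_ge0 : 0 <= s + A by rewrite addr_ge0.
rewrite /norm2 big_ord_recl big_ord1 !mxE /=.
rewrite -[X in _ <= X](ger0_norm sA_ge0) -sqrtr_sqr ler_sqrt ?sqr_ge0 //.
rewrite -subr_ge0 -[RHS]subr_ge0; congr (0 <= _); ring.
Qed.

Section Location.
Variables (R : realType) (I J JL JF : finType) (P : cflp R I J JL JF).
Implicit Types x y : {ffun J -> bool}.

Notation h := (demand P).
Notation p := (lbudget P).
Notation r := (fbudget P).
Notation A := (leader_attraction P).
Notation F := (follower_attraction P).

(** * Binary vectors as sets of sites, and signs of the attractions *)

Lemma sum_binary_card x : (\sum_j x j)%N = #|[set j | x j]|.
Proof.
by rewrite -sum1dep_card [RHS]big_mkcond; apply: eq_bigr => j _; case: (x j).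
Qed.

Lemma binary_extend n x : (n <= #|J|)%N -> x \in binary_le J n ->
  exists2 x', x' \in binary_eq J n & forall j, x j -> x' j.
Proof.
move=> le_nJ; rewrite inE sum_binary_card; set D := [set j | x j] => le_Dn.
(* With a constant value function, [top_subset] merely supplies a set of the missing size. *)
have [|B [sB cardB _]] := @top_subset R _ (fun=> 0) (~: D) (n - #|D|).
  by rewrite -(leq_add2l #|D|) cardsC subnKC.
exists [ffun j => j \in D :|: B].
  rewrite inE sum_binary_card; apply/eqP.
  have -> : [set j | [ffun j => j \in D :|: B] j] = D :|: B.
    by apply/setP=> j; rewrite inE ffunE.
  have disDB : D :&: B = set0.
    by apply/eqP; rewrite setI_eq0 disjoint_sym disjoints_subset.
  by rewrite cardsU disDB cards0 subn0 cardB subnKC.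
by move=> j xj; rewrite ffunE !inE xj.
Qed.

Lemma w_gt0 i j : 0 < w P i j.
Proof. exact: expR_gt0. Qed.

Lemma UL_ge0 i : 0 <= UL P i.
Proof. by apply: sumr_ge0 => j _; apply: expR_ge0. Qed.

Lemma UF_ge0 i : 0 <= UF P i.
Proof. by apply: sumr_ge0 => j _; apply: expR_ge0. Qed.

Lemma w_sum_ge0 i (z : J -> bool) : 0 <= \sum_j w P i j * (z j)%:R.
Proof. by apply: sumr_ge0 => j _; rewrite mulr_ge0 ?ler0n // ltW ?w_gt0. Qed.

Lemma le_w_sum i (z z' : J -> bool) : (forall j, z j -> z' j) ->
  \sum_j w P i j * (z j)%:R <= \sum_j w P i j * (z' j)%:R.
Proof.
move=> sub; apply: ler_sum => j _; apply: ler_wpM2l; first exact/ltW/w_gt0.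
by rewrite ler_nat; have := sub j; case: (z j) => // ->.
Qed.

Lemma w_sum_gt0 n i z : (0 < n)%N -> z \in binary_eq J n ->
  0 < \sum_j w P i j * (z j)%:R.
Proof.
rewrite inE sum_binary_card => n_gt0 /eqP card_z.
have /card_gt0P[j] : (0 < #|[set j | z j]|)%N by rewrite card_z.
rewrite inE => zj; rewrite (bigD1 j) //= zj mulr1 ltr_wpDr ?w_gt0 //.
by apply: sumr_ge0 => k _; rewrite mulr_ge0 ?ler0n // ltW ?w_gt0.
Qed.

Lemma leader_attraction_ge0 x i : 0 <= A x i.
Proof. by rewrite addr_ge0 ?UL_ge0 ?w_sum_ge0. Qed.

Lemma follower_attraction_ge0 x i : 0 <= F x i.
Proof. by rewrite addr_ge0 ?UF_ge0 ?w_sum_ge0. Qed.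

Lemma leader_attraction_gt0 x i :
  (0 < p)%N -> x \in Xbar P -> 0 < A x i.
Proof. by move=> p_gt0 xX; rewrite ltr_wpDl ?UL_ge0 ?(w_sum_gt0 _ p_gt0). Qed.

Lemma follower_attraction_gt0 x i :
  (0 < r)%N -> x \in Ybar P -> 0 < F x i.
Proof. by move=> r_gt0 xX; rewrite ltr_wpDl ?UF_ge0 ?(w_sum_gt0 _ r_gt0). Qed.

(* What the follower attracts when it only opens sites of [y] not in [x]. *)
Definition residual x y i : R :=
  UF P i + \sum_j w P i j * (y j && ~~ x j)%:R.

Lemma residual_ge0 x y i : 0 <= residual x y i.
Proof. by rewrite addr_ge0 ?UF_ge0 ?w_sum_ge0. Qed.

Lemma residual_Yof x y i : y \in Yof P x -> residual x y i = F y i.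
Proof.
rewrite inE => /andP[_ /forallP dis]; congr (_ + _); apply: eq_bigr => j _.
by have := dis j; case: (x j); case: (y j).
Qed.

(** * Shares in terms of attractions *)

Lemma leader_shareE x y :
  leader_share P x y = \sum_i h i * (A x i / (A x i + F y i)).
Proof.
apply: eq_bigr => i _; congr (_ * (_ / _)); rewrite /leader_attraction.
under eq_bigr do rewrite mulrDr.
by rewrite big_split /= /follower_attraction; ring.
Qed.

Lemma follower_shareE x y :
  follower_share P x y = \sum_i h i * (F y i / (A x i + F y i)).
Proof.
apply: eq_bigr => i _; congr (_ * (_ / _)); rewrite /leader_attraction.
under eq_bigr do rewrite mulrDr.
by rewrite big_split /= /follower_attraction; ring.
Qed.

(** On bits, the maximum of [x j] and [y j] is [x j] plus the bit [y j && ~~ x j]. *)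
Lemma L_residual x y :
  L P x y = \sum_i h i * (A x i / (A x i + residual x y i)).
Proof.
apply: eq_bigr => i _; congr (_ * (_ / _));
rewrite /leader_attraction /residual.
rewrite addrACA -big_split; congr (_ + _); apply: eq_bigr => j _ /=.
rewrite -mulrDr; congr (_ * _).
by case: (x j); case: (y j);
  rewrite ?maxxx ?(max_l ler01) ?(max_r ler01) ?addr0 ?add0r.
Qed.

Lemma share_inv (a b : R) : 0 < a -> a / (a + b) = (1 + b / a)^-1.
Proof.
move=> a_gt0; have a_neq0 : a != 0 by rewrite gt_eqF.
have -> : a + b = a * (1 + b / a) by field.
by rewrite invfM mulrA divff // mul1r.
Qed.

Lemma share_le (a a' b : R) :
  0 <= a -> a <= a' -> 0 < b -> a / (a + b) <= a' / (a' + b).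
Proof.
move=> a_ge0 le_aa' b_gt0.
have ab_gt0 : 0 < a + b by lra.
have a'b_gt0 : 0 < a' + b by lra.
rewrite ler_pdivrMr // mulrAC ler_pdivlMr //.
have : a * b <= a' * b by rewrite ler_wpM2r // ltW.
by lra.
Qed.

Section Bounds.
Hypothesis h_ge0 : forall i, 0 <= h i.
Hypothesis h_sum1 : \sum_i h i = 1.
Hypothesis p_gt0 : (0 < p)%N.
Hypothesis r_gt0 : (0 < r)%N.
Hypothesis le_prJ : (p + r <= #|J|)%N.

Let le_pJ : (p <= #|J|)%N.
Proof. exact: leq_trans (leq_addr _ _) le_prJ. Qed.

Let le_rJ : (r <= #|J|)%N.
Proof. exact: leq_trans (leq_addl _ _) le_prJ. Qed.

(** * Budget-exact decisions and monotonicity of the shares *)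

Lemma binary_eq_neq0 n : (n <= #|J|)%N -> binary_eq J n != set0.
Proof.
move=> le_nJ; have [|z zn _] := @binary_extend n [ffun=> false] le_nJ.
  by rewrite inE big1 // => j _; rewrite ffunE.
by apply/set0Pn; exists z.
Qed.

Lemma Ybar_sub_Y y : y \in Ybar P -> y \in Y P.
Proof. by rewrite !inE => /eqP ->. Qed.

Lemma Xbar_sub_X x : x \in Xbar P -> x \in X P.
Proof. by rewrite !inE => /eqP ->. Qed.

Lemma Yof_sub x x' y : (forall j, x j -> x' j) ->
  y \in Yof P x' -> y \in Yof P x.
Proof.
move=> sub; rewrite !inE => /andP[-> /forallP dis]; apply/forallP => j.
by have := dis j; have := sub j; case: (x j) => [->|] //; case: (y j).
Qed.

Lemma L_antitone x y y' : (forall i, 0 < A x i) -> (forall j, y j -> y' j) ->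
  L P x y' <= L P x y.
Proof.
move=> A_gt0 sub; rewrite !L_residual; apply: ler_sum => i _.
apply: ler_wpM2l => //; apply: ler_wpM2l; first exact/ltW/A_gt0.
have D_gt0 z : 0 < A x i + residual x z i by rewrite ltr_wpDr ?residual_ge0.
rewrite lef_pV2 ?posrE // lerD2l /residual lerD2l.
by apply: le_w_sum => j /andP[/sub -> ->].
Qed.

Lemma leader_share_le x x' y : (forall j, x j -> x' j) -> y \in Ybar P ->
  leader_share P x y <= leader_share P x' y.
Proof.
move=> sub yY; rewrite !leader_shareE; apply: ler_sum => i _.
apply: ler_wpM2l => //; apply: share_le.
- exact: leader_attraction_ge0.
- by rewrite /leader_attraction lerD2l; apply: le_w_sum.
- exact: follower_attraction_gt0.
Qed.

Lemma L_Yof x y : y \in Yof P x -> L P x y = leader_share P x y.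
Proof.
move=> yY; rewrite L_residual leader_shareE.
by apply: eq_bigr => i _; rewrite residual_Yof.
Qed.

(* Only an inequality, because of the convention 0 / 0 = 0. *)
Lemma shares_le1 x y : leader_share P x y + follower_share P x y <= 1.
Proof.
rewrite leader_shareE follower_shareE -big_split -h_sum1 /=.
apply: ler_sum => i _; rewrite -mulrDr -mulrDl ler_piMr //.
by have [->|/divff->] := eqVneq (A x i + F y i) 0; rewrite ?mul0r ?ler01.
Qed.

(** Opening exactly [r > 0] sites makes every denominator positive, so 0 / 0 does not occur. *)
Lemma shares_eq1 x y : y \in Ybar P ->
  leader_share P x y + follower_share P x y = 1.
Proof.
move=> yY; rewrite leader_shareE follower_shareE -big_split -h_sum1 /=.
apply: eq_bigr => i _; rewrite -mulrDr -mulrDl divff ?mulr1 //.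
by rewrite gt_eqF // ltr_wpDl ?leader_attraction_ge0 ?follower_attraction_gt0.
Qed.

(** * Duality for the conic program at fixed [x] *)

(** The first cone reads [s i * A x i >= 1], which a zero attraction violates. *)
Lemma socp_attraction_gt0 x lam mu s t i :
  socp_feasible P x lam mu s t -> 0 < A x i.
Proof.
case=> _ /(_ i) cone _ _ _ /(_ i) s_ge0 _; move: cone.
rewrite norm2_cone ?leader_attraction_ge0 // lt_def leader_attraction_ge0 andbT.
by case: eqP => // ->; rewrite !mulr0; lra.
Qed.

(** The cones force [s i >= 1 / A x i] and [t i j >= (1 - x j) / A x i]. Weighting the constraint of
    site [j] by [y j] and summing then bounds the ratio, since [y] has exactly [r] ones and [mu] is
    nonnegative. *)
Lemma socp_weak_duality x lam mu s t y :
  socp_feasible P x lam mu s t -> y \in Ybar P ->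
  \sum_i h i * (residual x y i / A x i) <= socp_cost P lam mu s.
Proof.
move=> feas; have A_gt0 i := socp_attraction_gt0 i feas.
case: feas => dual cone_s cone_t _ mu_ge0 s_ge0 t_ge0.
rewrite inE => /eqP sum_y.
have le_s i : (A x i)^-1 <= s i.
  have := cone_s i; rewrite norm2_cone ?(ltW (A_gt0 i)) // => cone.
  by rewrite -[leLHS]mul1r ler_pdivrMr //; move: cone; rewrite expr2; lra.
have le_t i j : (~~ x j)%:R / A x i <= t i j.
  have := cone_t i j; rewrite norm2_cone ?(ltW (A_gt0 i)) // => cone.
  rewrite ler_pdivrMr //; move: cone; rewrite expr2.
  by case: (x j) => /=; lra.
(* Split into the part of existing facilities and, by exchanging sums, the value of each site
   weighted by [y j]. *)
have -> : \sum_i h i * (residual x y i / A x i) =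
   \sum_i h i * UF P i * (A x i)^-1
   + \sum_j (\sum_i h i * w P i j * ((~~ x j)%:R / A x i)) * (y j)%:R.
  under [X in _ = _ + X]eq_bigr do rewrite mulr_suml.
  rewrite exchange_big -big_split; apply: eq_bigr => i _ /=.
  rewrite /residual mulrDl mulrDr mulr_suml mulr_sumr mulrA; congr (_ + _).
  apply: eq_bigr => j _; rewrite -mulnb natrM; ring.
rewrite /socp_cost; have -> : r%:R * lam = \sum_j lam * (y j)%:R.
  by rewrite -mulr_sumr -natr_sum sum_y mulrC.
rewrite -addrA; apply: lerD.
  by apply: ler_sum => i _; rewrite ler_wpM2l // mulr_ge0 ?UF_ge0.
rewrite -big_split; apply: ler_sum => j _ /=.
have le_dual : \sum_i h i * w P i j * ((~~ x j)%:R / A x i) <= lam + mu j.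
  apply: le_trans (dual j); apply: ler_sum => i _.
  by rewrite ler_wpM2l // mulr_ge0 // ltW ?w_gt0.
have := mu_ge0 j; case: (y j) => /=; lra.
Qed.

Lemma socp_cost_ge0 x lam mu s t :
  socp_feasible P x lam mu s t -> 0 <= socp_cost P lam mu s.
Proof.
move=> feas; have /set0Pn[y yY] := binary_eq_neq0 le_rJ.
apply: le_trans (socp_weak_duality feas yY); apply: sumr_ge0 => i _.
by rewrite mulr_ge0 // divr_ge0 ?residual_ge0 ?leader_attraction_ge0.
Qed.

(* The dual multiplier lam is the r-th largest site value among the sites left
   open by x, and mu the excess over it. *)
Lemma socp_strong_duality x : x \in Xbar P ->
  exists y lam mu s t, [/\ y \in Ybar P, y \in Yof P x,
    socp_feasible P x lam mu s t &
    socp_cost P lam mu s = \sum_i h i * (F y i / A x i)].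
Proof.
move=> xX; have A_gt0 i := leader_attraction_gt0 i p_gt0 xX.
have AV_ge0 i : 0 <= (A x i)^-1 by rewrite invr_ge0 ltW.
(* The least value the second cone allows; it vanishes on sites opened by [x], and then so does the
   site value [c]. *)
pose t i j := (~~ x j)%:R / A x i.
have t_ge0 i j : 0 <= t i j by rewrite mulr_ge0 ?ler0n.
pose c j := \sum_i h i * w P i j * t i j.
have c_ge0 j : 0 <= c j.
  by apply: sumr_ge0 => i _; rewrite !mulr_ge0 // ltW ?w_gt0.
(* [p + r <= #|J|] leaves at least [r] sites outside [x], and [B] collects the [r] most valuable of
   them. *)
have [|B [sB cardB topB]] := @top_subset R _ c [set j | ~~ x j] r.
  have -> : [set j | ~~ x j] = ~: [set j | x j] by apply/setP=> j; rewrite !inE.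
  have card_x : #|[set j | x j]| = p.
    by move: xX; rewrite inE sum_binary_card => /eqP.
  by rewrite -(leq_add2l p) -{2}card_x cardsC.
have B_neq0 : B != set0 by rewrite -card_gt0 cardB.
have [[b bB lamE] lam_le] := fminP c B_neq0.
set lam := fmin B c in lamE lam_le.
pose y : {ffun J -> bool} := [ffun j => j \in B].
have yE j : y j = (j \in B) by rewrite ffunE.
have yY : y \in Ybar P.
  rewrite inE sum_binary_card -cardB; apply/eqP/eq_card => j.
  by rewrite inE yE.
(* A site of [x] has value 0, below any value in [B]; the other sites outside [B] are dominated by
   the choice of [B]. *)
have le_lam j : j \notin B -> c j <= lam.
  move=> jB; rewrite lamE; case: (boolP (x j)) => xj; last first.
    by apply: topB; rewrite ?inE.
  by rewrite {1}/c big1 // => i _; rewrite /t xj mul0r mulr0.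
exists y, lam, (fun j => if j \in B then c j - lam else 0).
exists (fun i => (A x i)^-1), t.
have yYx : y \in Yof P x.
  rewrite inE Ybar_sub_Y //; apply/forallP=> j; rewrite yE.
  by case: (boolP (j \in B)) => // /(subsetP sB); rewrite inE => /negbTE ->.
split=> //.
  split=> //.
  - move=> j; rewrite -/(c j).
    by case: ifP => [_|/negbT /le_lam]; lra.
  - move=> i; rewrite norm2_cone ?(ltW (A_gt0 i)) //.
    by rewrite mulVf ?gt_eqF // expr2; lra.
  - move=> i j; rewrite norm2_cone ?(ltW (A_gt0 i)) //.
    rewrite divfK ?gt_eqF // expr2.
    by case: (x j) => /=; lra.
  - exact: Xbar_sub_X.
  - by move=> j; case: ifP => // /lam_le; rewrite subr_ge0.
(* As [B] has [r] elements, the [lam] subtracted in [mu] cancel against [r * lam]. *)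
rewrite /socp_cost -big_mkcond /= sumrB sumr_const cardB mulr_natl.
rewrite -addrA (addrC (lam *+ r)) subrK.
have -> : \sum_(j in B) c j = \sum_i \sum_(j in B) h i * w P i j * t i j.
  exact: exchange_big.
rewrite -big_split; apply: eq_bigr => i _ /=.
rewrite /follower_attraction mulrDl mulrDr mulrA; congr (_ + _).
rewrite mulr_suml mulr_sumr big_mkcond; apply: eq_bigr => j _ /=.
rewrite yE; case: ifP => jB; last by rewrite mulr0 mul0r mulr0.
have := subsetP sB _ jB; rewrite /t inE => -> /=.
by ring.
Qed.

(** * Range of the individual shares *)

Lemma inv1D_le (a b : R) : 0 <= a -> a <= b -> (1 + b)^-1 <= (1 + a)^-1.
Proof. by move=> a_ge0 le_ab; rewrite lef_pV2 ?posrE; lra. Qed.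

Lemma gamma_bounds x y i : x \in Xbar P -> y \in Ybar P ->
  gamma_m P <= (1 + F y i / A x i)^-1 <= gamma_M P.
Proof.
move=> xX yY.
have I_neq0 : [set: I] != set0 by apply/set0Pn; exists i; rewrite inE.
have [[x0 x0X minAE] minA] := fminP (A^~ i) (binary_eq_neq0 le_pJ).
have [[x1 x1X maxAE] maxA] := fmaxP (A^~ i) (binary_eq_neq0 le_pJ).
have [[y0 y0Y minFE] minF] := fminP (F^~ i) (binary_eq_neq0 le_rJ).
have [[y1 y1Y maxFE] maxF] := fmaxP (F^~ i) (binary_eq_neq0 le_rJ).
have Ax_gt0 x2 : x2 \in Xbar P -> 0 < A x2 i.
  exact: leader_attraction_gt0.
apply/andP; split.
  apply: le_trans ((fminP _ I_neq0).2 i (in_setT i)) _ => /=.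
  rewrite div1r; apply: inv1D_le.
    by rewrite divr_ge0 ?follower_attraction_ge0 ?leader_attraction_ge0.
  apply: ler_pM; rewrite ?invr_ge0 ?follower_attraction_ge0
    ?leader_attraction_ge0 //.
    exact: maxF.
  by rewrite lef_pV2 ?posrE ?Ax_gt0 ?minA // minAE Ax_gt0.
apply: le_trans ((fmaxP _ I_neq0).2 i (in_setT i)) => /=.
rewrite div1r; apply: inv1D_le.
  by rewrite minFE maxAE divr_ge0 ?follower_attraction_ge0
    ?leader_attraction_ge0.
apply: ler_pM; rewrite ?invr_ge0 ?maxAE ?leader_attraction_ge0 //.
- by rewrite minFE follower_attraction_ge0.
- exact: minF.
- by rewrite lef_pV2 ?posrE ?Ax_gt0 // -maxAE maxA.
Qed.

Lemma gamma_m_gt0 : (0 < #|I|)%N -> 0 < gamma_m P.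
Proof.
move=> I_gt0; have I_neq0 : [set: I] != set0 by rewrite -card_gt0 cardsT.
rewrite /gamma_m; set g := fun i => _; have [[i _ ->] _] := fminP g I_neq0.
rewrite /g; have [[x0 _ ->] _] := fminP (A^~ i) (binary_eq_neq0 le_pJ).
have [[y1 _ ->] _] := fmaxP (F^~ i) (binary_eq_neq0 le_rJ).
rewrite div1r invr_gt0 ltr_wpDr // divr_ge0 ?follower_attraction_ge0 //.
exact: leader_attraction_ge0.
Qed.

(** * Comparison of the conic and bilevel values *)

Lemma follower_optimal_exists x : exists y, follower_optimal P x y.
Proof.
have Y_neq0 : Yof P x != set0.
  apply/set0Pn; exists [ffun=> false]; rewrite !inE.
  rewrite big1 => [|j _]; last by rewrite ffunE.
  by apply/forallP => j; rewrite ffunE.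
have [[y yY maxE] max] := fmaxP (follower_share P x) Y_neq0.
by exists y; split=> // y' y'Y; rewrite -maxE max.
Qed.

Lemma scflp_objective_ge x lam mu s t : socp_feasible P x lam mu s t ->
  (1 + socp_cost P lam mu s)^-1 <= scflp_objective P x.
Proof.
move=> feas; have A_gt0 i := socp_attraction_gt0 i feas.
have Y_neq0 : Y P != set0.
  have /set0Pn[y yY] := binary_eq_neq0 le_rJ.
  by apply/set0Pn; exists y; apply: Ybar_sub_Y.
have [[y yY objE] _] := fminP (L P x) Y_neq0.
rewrite /scflp_objective objE.
(* The minimiser may open fewer than [r] sites; completing it to [r] only lowers [L] and makes weak
   duality applicable. *)
have [y' y'Y sub] := binary_extend le_rJ yY.
apply: le_trans (L_antitone A_gt0 sub); rewrite L_residual.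
under eq_bigr do rewrite share_inv //.
apply: harmonic_le_arithmetic => // [i|].
  by rewrite divr_ge0 ?residual_ge0 // ltW.
exact: socp_weak_duality feas y'Y.
Qed.

(** An optimal follower response to [x] lies in [Y], and there [L] is the leader's share, which is
    at most [z]. *)
Lemma scflp_objective_le x z : x \in X P -> scflp_optimal_value P z ->
  scflp_objective P x <= z.
Proof.
move=> xX [_ maxz]; have [y opty] := follower_optimal_exists x.
apply: le_trans (maxz x y xX opty).
have yYx := opty.1; rewrite -L_Yof //.
have yY : y \in Y P by move: yYx; rewrite inE => /andP[].
apply: (fminP (L P x) _).2 => //.
by apply/set0Pn; exists y.
Qed.

Lemma scflp_optimal_value_le z : (0 < #|I|)%N -> scflp_optimal_value P z ->
  exists x lam mu s t, socp_feasible P x lam mu s t /\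
    4 * gamma_M P * gamma_m P / (gamma_M P + gamma_m P) ^+ 2 * z
      <= (1 + socp_cost P lam mu s)^-1.
Proof.
move=> I_gt0 [[x [y [xX [yY opty] ->]]] _].
have [x' x'X sub] := binary_extend le_pJ xX.
have [y' [lam [mu [s [t [y'Y y'Yx' feas costE]]]]]] := socp_strong_duality x'X.
exists x', lam, mu, s, t; split=> //.
have m_gt0 := gamma_m_gt0 I_gt0.
have bounds i := gamma_bounds i x'X y'Y.
have m_le_M : gamma_m P <= gamma_M P.
  by have /card_gt0P[i _] := I_gt0; have /andP[/le_trans] := bounds i; apply.
(* [y'] avoids [x'], hence [x], so it was available against [x] and earns the follower no more than
   [y]. Passing to complements, the leader does at least as well against [y'], and better still
   after enlarging [x] to [x']. *)
have le_z : leader_share P x y <= leader_share P x' y'.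
  apply: le_trans (leader_share_le sub y'Y).
  have := opty y' (Yof_sub sub y'Yx').
  have := shares_le1 x y; have := shares_eq1 x y'Y; lra.
have rho_ge0 i : 0 <= F y' i / A x' i.
  by rewrite divr_ge0 ?follower_attraction_ge0 ?leader_attraction_ge0.
rewrite costE.
apply: le_trans (kantorovich h_ge0 h_sum1 m_gt0 m_le_M rho_ge0 bounds).
apply: ler_wpM2l.
  exact: kantorovich_constant_ge0.
apply: le_trans le_z _; rewrite leader_shareE.
by under eq_bigr do rewrite share_inv ?leader_attraction_gt0 //.
Qed.

End Bounds.

End Location.

Theorem theorem3 (R : realType) (I J JL JF : finType)
    (P : cflp R I J JL JF)
    (hI : (0 < #|I|)%N)
    (demand_ge0 : forall i, 0 <= demand P i)
    (demand_sum1 : \sum_i demand P i = 1)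
    (dist_ge0 : forall i j, 0 <= dist P i j)
    (decay_gt0 : 0 < decay P)
    (lbudget_gt0 : (0 < lbudget P)%N)
    (fbudget_gt0 : (0 < fbudget P)%N)
    (budgets_le : (lbudget P + fbudget P <= #|J|)%N)
    (zstar : R)
    (hzstar : scflp_optimal_value P zstar)
    (xH : {ffun J -> bool}) (lam : R) (mu : J -> R)
    (s : I -> R) (t : I -> J -> R)
    (hxH : socp_optimal P xH lam mu s t) :
  4 * gamma_M P * gamma_m P / (gamma_M P + gamma_m P) ^+ 2
    <= scflp_objective P xH / zstar /\
  scflp_objective P xH / zstar <= 1.
Proof.
have [feas opt] := hxH.
have [x' [lam' [mu' [s' [t' [feas' le_z]]]]]] :=
  scflp_optimal_value_le demand_ge0 demand_sum1 lbudget_gt0 fbudget_gt0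
    budgets_le hI hzstar.
have cost_ge0 : 0 <= socp_cost P lam mu s.
  exact: (socp_cost_ge0 demand_ge0 budgets_le feas).
have zH_ge := scflp_objective_ge demand_ge0 demand_sum1 budgets_le feas.
have zH_le := scflp_objective_le (socp_x feas) hzstar.
(* A positive [zH] makes [zstar] positive too, so the quotient can be cleared. *)
have zH_gt0 : 0 < scflp_objective P xH.
  by apply: lt_le_trans zH_ge; rewrite invr_gt0; lra.
have zstar_gt0 : 0 < zstar by apply: lt_le_trans zH_le.
split; last by rewrite ler_pdivrMr // mul1r.
(* Optimality of [xH] makes its cost at most that of the completed decision [x'], which links the
   two bounds. *)
rewrite ler_pdivlMr //; apply: le_trans le_z _; apply: le_trans zH_ge.
by apply: inv1D_le => //; apply: opt feas'.
Qed.
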